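(* Every chainable continuum that contains a subspace homeomorphic to complete Erdős space $\mathfrak{E}_{\mathrm{c}}$ is non-Suslinian. In particular, $\mathfrak{E}_{\mathrm{c}}$ is not homeomorphic to the endpoint set $E(X)$ of any Suslinian chainable continuum $X$.
   Context: A continuum is a compact connected metric space. A continuum $X$ is Suslinian if there is no uncountable collection of pairwise disjoint non-degenerate subcontinua of $X$ (non-degenerate means having more than one point); otherwise it is non-Suslinian. For $\varepsilon>0$, an $\varepsilon$-chain covering $X$ is a finite sequence of open sets $U_1,\ldots,U_n$ covering $X$ such that $\operatorname{diam}(U_i)<\varepsilon$ for all $i\le n$, and $U_i\cap U_j\neq\varnothing$ if and only if $|i-j|\leq 1$, for all $i,j\leq n$. A continuum $X$ is chainable if for every $\varepsilon>0$ there is an $\varepsilon$-chain covering $X$. A point $x$ of a chainable continuum $X$ is an endpoint of $X$ if for every $\varepsilon>0$ there is an $\varepsilon$-chain $U_1,\ldots,U_n$ covering $X$ with $x\in U_1$. The set of all endpoints of $X$ is denoted $E(X)$, with the subspace topology. Complete Erdős space is the subspace $\mathfrak{E}_{\mathrm{c}}=\{x=(x_n)_{n\ge 1}\in\ell^2 : x_n\in\mathbb{R}\setminus\mathbb{Q}\text{ for every } n\}$ of the real Hilbert space $\ell^2$ of square-summable sequences with the norm topology. It is a known fact that $\mathfrak{E}_{\mathrm{c}}$ is a totally disconnected Polish space (totally disconnected: no connected subset with more than one point) that is not zero-dimensional at any of its points, where a space $Y$ is zero-dimensional at $y\in Y$ if every neighborhood of $y$ contains a clopen neighborhood of $y$.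 *)

(* Defs.v *)
From HB Require Import structures.
From mathcomp Require Import all_boot all_order all_algebra.
From mathcomp Require Import all_classical all_reals all_analysis.
From mathcomp Require Import ring lra.

Set Implicit Arguments.
Unset Strict Implicit.
Unset Printing Implicit Defensive.

Import Order.TTheory GRing.Theory Num.Theory.
Import numFieldNormedType.Exports.

Local Open Scope classical_set_scope.
Local Open Scope ring_scope.

Definition homeomorphic (S T : topologicalType) : Prop :=
  exists (f : S -> T) (g : T -> S),
    [/\ continuous f, continuous g, cancel f g & cancel g f].

Section continua.
Context {R : realType}.
Implicit Type X : metricType R.

Definition continuum X : Prop := compact [set: X] /\ connected [set: X].

Definition nondegenerate_subcontinuum X (K : set X) : Prop :=
  [/\ compact K, connected K & exists x y, [/\ K x, K y & x <> y]].

Definition suslinian X : Prop :=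
  ~ exists C : set (set X),
      [/\ ~ countable C, C `<=` @nondegenerate_subcontinuum X
        & trivIset C id].

(* Extended-real valued, as the real-valued [sup] of an unbounded set is 0. *)
Definition diam X (U : set X) : \bar R :=
  ereal_sup [set (mdist p.1 p.2)%:E | p in U `*` U].

(* Links are indexed from 0: [U i] is the link with number i + 1. *)
Definition chain_covering X (e : R) (n : nat) (U : 'I_n -> set X) : Prop :=
  [/\ forall i, open (U i),
      \bigcup_i U i = [set: X],
      forall i, (diam (U i) < e%:E)%E
    & forall i j, U i `&` U j !=set0 <-> (`|i - j|%N <= 1)%N].

Definition chainable X : Prop :=
  forall e : R, 0 < e ->
    exists (n : nat) (U : 'I_n -> set X), chain_covering e U.

Definition endpoints X : set X :=
  [set x | forall e : R, 0 < e ->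
    exists (n : nat) (U : 'I_n.+1 -> set X), chain_covering e U /\ U ord0 x].

End continua.

Arguments continuum {R} X.
Arguments suslinian {R} X.
Arguments chainable {R} X.
Arguments endpoints {R} X.

Section square_summable.
Context {R : realType}.
Implicit Types a b x y : nat -> R.

Definition square_summable x : Prop := cvgn [series x k ^+ 2]_k.

Definition l2norm x : R := Num.sqrt (limn [series x k ^+ 2]_k).

End square_summable.

Record l2 (R : realType) := L2 {
  l2_seq :> nat -> R ;
  l2_summable : square_summable l2_seq
}.

Section l2_metric.
Context {R : realType}.
Implicit Types a b : nat -> R.
Implicit Types x y z : l2 R.

Lemma square_summable_le a b :
  (forall n, a n ^+ 2 <= b n) -> cvgn (series b) -> square_summable a.
Proof.
move=> ab; apply: (@series_le_cvg R (fun k => a k ^+ 2) b) => // n.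
- exact: sqr_ge0.
- exact: le_trans (sqr_ge0 _) (ab n).
Qed.

Lemma square_summableD a b : square_summable a -> square_summable b ->
  square_summable (fun n => a n + b n).
Proof.
move=> ca cb.
apply: (@square_summable_le _ (2 *: (fun n => a n ^+ 2 : R)
  + 2 *: (fun n => b n ^+ 2 : R))).
  by move=> n; rewrite -subr_ge0 !fctE /GRing.scale /=; have := sqr_ge0 (a n - b n); nra.
by apply: is_cvg_seriesD; apply: is_cvg_seriesZ.
Qed.

Lemma square_summableN a : square_summable a ->
  square_summable (fun n => - a n).
Proof.
by rewrite /square_summable; under [in X in _ -> X]eq_fun do rewrite sqrrN.
Qed.

Lemma square_summableB a b : square_summable a -> square_summable b ->
  square_summable (fun n => a n - b n).
Proof. by move=> ca /square_summableN; exact: square_summableD. Qed.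

Lemma l2norm_ge0 a : 0 <= l2norm a. Proof. exact: sqrtr_ge0. Qed.

Lemma l2norm_sqr a : square_summable a ->
  l2norm a ^+ 2 = limn [series a k ^+ 2]_k.
Proof.
move=> ca; rewrite sqr_sqrtr//; apply: limr_ge => //; apply: nearW => n.
by apply: sumr_ge0 => i _; exact: sqr_ge0.
Qed.

Lemma le_l2norm a n : square_summable a -> `|a n| <= l2norm a.
Proof.
move=> ca; rewrite -(@ler_pXn2r R 2)// ?nnegrE ?l2norm_ge0//.
rewrite l2norm_sqr// real_normK ?num_real//.
apply: le_trans (nondecreasing_cvgn_le _ ca n.+1); last first.
  by apply: nondecreasing_series => k _ _; exact: sqr_ge0.
by rewrite /series/= big_nat_recr//= lerDr sumr_ge0// => i _; exact: sqr_ge0.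
Qed.

Lemma l2norm_eq0 a n : square_summable a -> l2norm a = 0 -> a n = 0.
Proof.
by move=> /(le_l2norm n) + a0; rewrite a0 normr_le0 => /eqP.
Qed.

Lemma ler_l2normD a b : square_summable a -> square_summable b ->
  l2norm (fun n => a n + b n) <= l2norm a + l2norm b.
Proof.
move=> ca cb.
have [a0|a0] := eqVneq (l2norm a) 0.
  rewrite a0 add0r; under eq_fun do rewrite (l2norm_eq0 _ ca a0) add0r.
  exact: lexx.
have [b0|b0] := eqVneq (l2norm b) 0.
  rewrite b0 addr0; under eq_fun do rewrite (l2norm_eq0 _ cb b0) addr0.
  exact: lexx.
have A0 : 0 < l2norm a by rewrite lt_def a0 l2norm_ge0.
have B0 : 0 < l2norm b by rewrite lt_def b0 l2norm_ge0.
set A := l2norm a in A0 a0 *; set B := l2norm b in B0 b0 *.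
rewrite -(@ler_pXn2r R 2)// ?nnegrE ?l2norm_ge0 ?addr_ge0 ?l2norm_ge0//.
rewrite l2norm_sqr; last exact: square_summableD.
pose t := B / A; have t0 : 0 < t by rewrite divr_gt0.
pose c := (1 + t) *: (fun n => a n ^+ 2 : R)
        + (1 + t^-1) *: (fun n => b n ^+ 2 : R).
have cc : cvgn (series c).
  by apply: is_cvg_seriesD; apply: is_cvg_seriesZ.
have limc : limn (series c) = (A + B) ^+ 2.
  rewrite lim_seriesD; [|exact: is_cvg_seriesZ..].
  rewrite !lim_seriesZ// -!l2norm_sqr// -/A -/B /GRing.scale/= /t.
  by field; rewrite a0 b0.
rewrite -limc; apply: lim_series_le => //; first exact: square_summableD.
move=> n; rewrite /c !fctE /GRing.scale /= -subr_ge0.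
have -> : (1 + t) * a n ^+ 2 + (1 + t^-1) * b n ^+ 2 - (a n + b n) ^+ 2
        = t^-1 * (t * a n - b n) ^+ 2.
  by field; rewrite gt_eqF.
by rewrite mulr_ge0 ?sqr_ge0// invr_ge0 ltW.
Qed.

Definition l2_dist x y : R := l2norm (fun n => x n - y n).

Lemma l2_eqP x y : (forall n, x n = y n) -> x = y.
Proof.
case: x y => [x cx] [y cy]/= /funext xy; rewrite xy in cx *.
by congr L2; exact: Prop_irrelevance.
Qed.

Lemma l2_distxx x : l2_dist x x = 0.
Proof.
rewrite /l2_dist /l2norm; under [X in series X]eq_fun do rewrite subrr expr0n/=.
rewrite [X in limn X](_ : _ = fun=> 0) ?lim_cst ?sqrtr0//.
by apply/funext => n; rewrite /series/= big1.
Qed.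

Lemma l2_dist_positivity x y : l2_dist x y = 0 -> x = y.
Proof.
move=> xy; apply: l2_eqP => n; apply/eqP; rewrite -subr_eq0; apply/eqP.
by move: xy; apply: (@l2norm_eq0 (fun n => x n - y n));
  apply: square_summableB; exact: l2_summable.
Qed.

Lemma l2_dist_sym x y : l2_dist x y = l2_dist y x.
Proof.
rewrite /l2_dist /l2norm; under eq_fun do rewrite -sqrrN opprB.
by [].
Qed.

Lemma l2_dist_triangle y x z : l2_dist x z <= l2_dist x y + l2_dist y z.
Proof.
have -> : l2_dist x z = l2norm (fun n => (x n - y n) + (y n - z n)).
  by congr l2norm; apply/funext => n; rewrite addrA subrK.
by apply: ler_l2normD; apply: square_summableB; exact: l2_summable.
Qed.

HB.instance Definition _ := gen_eqMixin (l2 R).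
HB.instance Definition _ := gen_choiceMixin (l2 R).
HB.instance Definition _ := isMetric.Build R (l2 R)
  l2_distxx l2_dist_positivity l2_dist_sym l2_dist_triangle.

End l2_metric.

Definition complete_erdos (R : realType) : set (l2 R) :=
  [set x : l2 R | forall n, irrational (x n)].
Arguments complete_erdos R : clear implicits.

(* Main.v *)
Require Import Defs.
From mathcomp Require Import all_boot all_order all_algebra.
From mathcomp Require Import all_classical all_reals all_analysis.
From mathcomp Require Import zify ring lra.
Import Order.TTheory GRing.Theory Num.Theory.
Import numFieldNormedType.Exports.

Set Implicit Arguments.
Unset Strict Implicit.
Unset Printing Implicit Defensive.

Local Open Scope classical_set_scope.
Local Open Scope ring_scope.

(** Complete Erdos space contains uncountably many disjoint closed copies of
    itself, its slices [x_0 = c] for [c] irrational.  Suppose that it sits in a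
    chainable continuum [X], let [S c] be the image of the slice at [c], [a c]
    a point of [S c], and [Z c] the component of [a c] in the closure of [S c].

    Each [Z c] is nondegenerate.  Otherwise, since components of compact sets
    are intersections of relatively clopen sets, [a c] would have arbitrarily
    small clopen neighbourhoods in the closure of [S c], hence bounded clopen
    neighbourhoods in the slice; Erdos's argument shows that a slice has no
    nonempty bounded clopen subset ([erdos_slice_unbounded]).

    The point [a d] does not lie in [Z c] when [d <> c], because [S c] is closed
    in the copy of Erdos space.  So among three of the [Z c], none is covered by
    the other two.  Chainable continua are atriodic: of three subcontinua that
    meet pairwise, one is covered by the other two ([chainable_atriodic]).
    Hence no three of the [Z c] meet pairwise.

    An uncountable family without three pairwise meeting members has an
    uncountable disjoint subfamily ([uncountable_disjoint_subfamily]), so [X] is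
    not Suslinian. *)

(** * Disjoint subfamilies *)

(** Take a maximal disjoint subfamily [E].  Every other member meets a member of
    [E], and the sets that meet a given member [Z e] are pairwise disjoint, as
    two of them that met would form a triangle with [Z e].  If [E] is countable,
    then the sets meeting some [Z e] form an uncountable disjoint family. *)
Lemma uncountable_disjoint_subfamily (T I : Type) (D : set I) (Z : I -> set T) :
  ~ countable D ->
  (forall t : 'I_3 -> I, injective t -> (forall p, D (t p)) ->
    ~ forall p q, p <> q -> Z (t p) `&` Z (t q) !=set0) ->
  exists D' : set I, [/\ ~ countable D', D' `<=` D & trivIset D' Z].
Proof.
move=> Dnc notriangle; apply: contrapT => noD'.
have ctD' D' : D' `<=` D -> trivIset D' Z -> countable D'.
  by move=> sD' tD'; apply: contrapT => ncD'; apply: noD'; exists D'.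
have [E [ED tE maxE]] := ex_maximal_disjoint_subcollection Z D.
pose N e := [set d | [/\ D d, d <> e & Z d `&` Z e !=set0]].
have cN e : E e -> countable (N e).
  move=> Ee; apply: ctD' => [d []//|i j [Di ie Zie] [Dj je Zje] Zij].
  apply: contrapT => ij; move/ED: Ee => De.
  apply: (notriangle (fun p : 'I_3 => nth e [:: i; j] p)).
  - move=> [[|[|[|//]]] ?] [[|[|[|//]]] ?] /= pq; apply: val_inj => //=;
      exfalso; by [apply: ij|apply: ie|apply: je].
  - by move=> [[|[|[|//]]] ?].
  - move=> [[|[|[|//]]] ?] [[|[|[|//]]] ?] /= pq => //; try by rewrite setIC.
    1-3: by exfalso; apply: pq; exact: val_inj.
apply: Dnc; apply: (@sub_countable _ _ _ (E `|` \bigcup_(e in E) N e)).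
  apply: subset_card_le => d Dd.
  have [Ed|nEd] := pselect (E d); [by left|right].
  apply: contrapT => nNd; apply: (maxE (E `|` [set d])).
  - split; first by move=> i Ei; left.
    by move=> /(_ d) h; apply: nEd; apply: h; right.
  - by move=> i [/ED//|->].
  - move=> i j [Ei|->] [Ej|->] //; first exact: tE.
    + move=> Zid; exfalso; apply: nNd; exists i => //; split => //.
        by move=> di; apply: nEd; rewrite di.
      by rewrite setIC.
    + move=> Zdj; exfalso; apply: nNd; exists j => //; split => //.
      by move=> di; apply: nEd; rewrite di.
rewrite -bigcup2E; apply: bigcup_countable => // -[|[|n]] _ //=.
- exact: ctD'.
- by apply: bigcup_countable => //; exact: ctD'.
Qed.

(** * Atriodicity of chainable spaces *)

(** If [Z] missed the link [U k], the unions of the links before and after [k]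
    would disconnect it: links that are not neighbours are disjoint. *)
Lemma connected_chain_link (R : realType) (X : metricType R) (e : R) n
    (U : 'I_n -> set X) (Z : set X) (i k j : 'I_n) :
  chain_covering e U -> connected Z -> (i < k < j)%N ->
  Z `&` U i !=set0 -> Z `&` U j !=set0 -> Z `&` U k !=set0.
Proof.
move=> [oU cU _ adj] cZ /andP[ik kj] [x [Zx Ux]] [y [Zy Uy]].
apply: contrapT => Zk.
pose A := \bigcup_(l in [set l : 'I_n | (l < k)%N]) U l.
pose B := \bigcup_(l in [set l : 'I_n | (k < l)%N]) U l.
have ZAB z : Z z -> A z \/ B z.
  move=> Zz; have : [set: X] z by [].
  rewrite -cU => -[l _ Ulz]; have [lk|kl|/val_inj lk] := ltngtP l k.
  - by left; exists l.
  - by right; exists l.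
  - by exfalso; apply: Zk; exists z; split => //; rewrite -lk.
have AB z : A z -> B z -> False.
  move=> [l /= lk Ul] [m /= km Um].
  have /adj : U l `&` U m !=set0 by exists z.
  by rewrite distnEr; lia.
have oA : open A by apply: bigcup_open => l _; exact: oU.
have oB : open B by apply: bigcup_open => l _; exact: oU.
have Ay : (Z `&` A) y.
  rewrite (cZ (Z `&` A)) //.
  - by exists x; split => //; exists i.
  - by exists A.
  - exists (~` B); first exact: open_closedC.
    apply/seteqP; split => z [Zz h]; split => //; first by move/(AB _ h).
    by case: (ZAB z Zz).
by case: Ay => _ /AB; apply; exists j.
Qed.

Lemma chain_link_diam (R : realType) (X : metricType R) (e : R) n
    (U : 'I_n -> set X) i x y :
  chain_covering e U -> U i x -> U i y -> mdist x y < e.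
Proof.
move=> [_ _ dU _] Ux Uy; rewrite -lte_fin; apply: le_lt_trans (dU i).
by apply: ereal_sup_ubound; exists (x, y).
Qed.

Lemma point_closed_sep (R : realType) (X : metricType R) (F : set X) x :
  closed F -> ~ F x -> exists2 e : R, 0 < e & forall y, mdist x y < e -> ~ F y.
Proof.
move=> cF Fx; have : nbhs x (~` F)
  by apply: open_nbhs_nbhs; split => //; exact: closed_openC.
rewrite -nbhs_ballE => -[e /= e0 he]; exists e => // y xy.
by apply: he; rewrite ballEmdist.
Qed.

(** Otherwise each [Z i] has a point [z i] outside the other two.  In a chain
    finer than the distances involved, the link [l i] of [z i] meets [Z i] only,
    while each [Z i] meets an interval of links.  If [l j] lies between [l i]
    and [l k], then [Z i] and [Z k] meet in a link [m], and on whichever side of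
    [l j] this link lies, the interval of [Z k] or of [Z i] contains [l j]. *)
Lemma chainable_atriodic (R : realType) (X : metricType R)
    (Z : 'I_3 -> set X) :
  chainable X -> (forall i, closed (Z i)) -> (forall i, connected (Z i)) ->
  (forall i j, i <> j -> Z i `&` Z j !=set0) ->
  exists i, Z i `<=` \bigcup_(j in [set~ i]) Z j.
Proof.
move=> chX clZ coZ ZZ; apply: contrapT => nsub.
have wit i : exists z, Z i z /\ forall j, j <> i -> ~ Z j z.
  apply: contrapT => h; apply: nsub; exists i => z Zz.
  apply: contrapT => nz; apply: h; exists z; split => // j ji Zj.
  by apply: nz; exists j.
have [z zP] := choice wit.
have [e e0 eP] : exists2 e : R, 0 < e &
    forall i j, j <> i -> forall y, mdist (z i) y < e -> ~ Z j y.
  have h (p : 'I_3 * 'I_3) : exists e : R, 0 < e /\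
      (p.2 <> p.1 -> forall y, mdist (z p.1) y < e -> ~ Z p.2 y).
    have [->|/eqP ne] := eqVneq p.2 p.1; first by exists 1.
    have [e e0 eP] := point_closed_sep (clZ p.2) ((zP p.1).2 _ ne).
    by exists e.
  have [d dP] := choice h.
  exists (\big[Order.min/1]_p d p).
    by apply: lt_bigmin => // p _; case: (dP p).
  move=> i j ji y zy; apply: ((dP (i, j)).2 ji) => //=.
  by apply: lt_le_trans zy _; exact: bigmin_le_cond.
have [n [U chU]] := chX e e0.
have lk i : exists l, U l (z i).
  have : [set: X] (z i) by [].
  by case: chU => _ <- _ _ [l _ ?]; exists l.
have [l lP] := choice lk.
have lZ i j : j <> i -> ~ (Z j `&` U (l i) !=set0).
  move=> ji [y [Zy Uy]]; apply: (eP i j ji y) => //.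
  exact: chain_link_diam chU _ Uy.
have Zl i : Z i `&` U (l i) !=set0.
  by exists (z i); split => //; case: (zP i).
have linj i j : i <> j -> l i <> l j :> nat.
  by move=> ij /val_inj e'; apply: (lZ i j) => [/esym//|]; rewrite e'.
have between i j k : i <> j -> j <> k -> i <> k -> (l i < l j < l k)%N -> False.
  move=> ij jk ik /andP[lij ljk].
  have [y [Zi Zk]] := ZZ i k ik.
  have : [set: X] y by [].
  case: (chU) => _ <- _ _ [m _ Um].
  have [mj|jm|mj] := ltngtP m (l j).
  - apply: (lZ j k); first exact: nesym.
    apply: (connected_chain_link chU (coZ k) (i := m) (j := l k)) => //.
      by rewrite mj.
    by exists y.
  - apply: (lZ j i) => //.
    apply: (connected_chain_link chU (coZ i) (i := l i) (j := m)) => //.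
      by rewrite lij.
    by exists y.
  - apply: (lZ j i) => //; exists y; split => //.
    by move/val_inj: mj => <-.
pose i0 : 'I_3 := @Ordinal 3 0 isT.
pose i1 : 'I_3 := @Ordinal 3 1 isT.
pose i2 : 'I_3 := @Ordinal 3 2 isT.
have i01 : i0 <> i1 by [].
have i12 : i1 <> i2 by [].
have i02 : i0 <> i2 by [].
(* some [l j] lies between the other two, and [between] excludes this *)
have := linj _ _ i01; have := linj _ _ i12; have := linj _ _ i02.
have := between i0 i1 i2 i01 i12 i02.
have := between i0 i2 i1 i02 (nesym i12) i01.
have := between i1 i0 i2 (nesym i01) i02 i12.
have := between i1 i2 i0 i12 (nesym i02) (nesym i01).
have := between i2 i0 i1 (nesym i02) i01 (nesym i12).
have := between i2 i1 i0 (nesym i12) (nesym i01) (nesym i02).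
lia.
Qed.

(** * Clopen neighbourhoods of components *)

(** Let [Q] be the intersection of the relatively clopen subsets of [K] that
    contain [x].  By compactness such a subset fits into any open set that
    contains [Q].  Normality then makes [Q] connected: a partition of [Q]
    extends to disjoint open sets, which cut a clopen subset between them into
    two clopen halves.  So [Q] lies in the component of [x]. *)
Lemma component_clopen_nbhs (R : realType) (X : metricType R) (K U : set X) x :
  compact K -> K x -> open U -> connected_component K x `<=` U ->
  exists F, [/\ closed F, closed (K `\` F), F `<=` K, F x & F `<=` U].
Proof.
move=> cK Kx oU sub.
have clK : closed K by exact: compact_closed (@metric_hausdorff _ _) cK.
pose C := [set F | [/\ closed F, closed (K `\` F), F `<=` K & F x]].
pose Q := \bigcap_(F in C) F.
have CK : C K by split => //; rewrite setDv; exact: closed0.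
have QK : Q `<=` K by move=> z; exact.
have Qx : Q x by move=> F [].
have clQ : closed Q by apply: closed_bigI => F [].
have CI F G : C F -> C G -> C (F `&` G).
  move=> [cF cF' FK Fx] [cG cG' GK Gx]; split => //.
  - exact: closedI.
  - by rewrite setDIr; exact: closedU.
  - by move=> z [/FK].
(* a cluster point of the sets [F `\` O] would lie in [Q] but not in [O] *)
have cpt O : open O -> Q `<=` O -> exists2 F, C F & F `<=` O.
  move=> oO QO; apply: contrapT => noF.
  pose B := filter_from C (fun F => F `\` O).
  have FB : Filter B.
    apply: filter_from_filter; first by exists K.
    move=> F G CF CG; exists (F `&` G); first exact: CI.
    by move=> z [[]].
  have PB : ProperFilter B.
    apply: filter_from_proper => F CF; apply: contrapT => FO.
    apply: noF; exists F => // z Fz; apply: contrapT => Oz.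
    by apply: FO; exists z.
  have [|p [Kp clp]] := cK B PB; first by exists K => // z [].
  have pF F : C F -> (F `\` O) p.
    move=> CF; suff : closure (F `\` O) p.
      have /closure_id <- // : closed (F `\` O).
      by apply: closedI; [case: CF|exact: open_closedC].
    by move=> N Np; apply: clp => //; exists F.
  have : O p by apply: QO => F /pF[].
  by case: (pF K CK).
have coQ : connected Q.
  move=> B [b Bb] [G oG BG] [H cH BH].
  have clB : closed B by rewrite BH; exact: closedI.
  have clB' : closed (Q `\` B).
    rewrite (_ : Q `\` B = Q `&` ~` G).
      by apply: closedI => //; exact: open_closedC.
    rewrite BG; apply/seteqP; split => z [Qz h]; split => //.
      by move=> Gz; apply: h.
    by move=> [].
  have BB' : B `&` (Q `\` B) = set0 by rewrite setDE setICA setICr setI0.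
  have [V [W [oV oW BV BW VW]]] := iffLR (@normal_openP R X)
    (@pseudometric_normal R X) B (Q `\` B) clB clB' BB'.
  have [F CF FVW] : exists2 F, C F & F `<=` V `|` W.
    apply: cpt; first exact: openU.
    by move=> z Qz; have [/BV|nB] := pselect (B z); [left|right; exact: BW].
  (* the side of a partition that contains [x] swallows all of [Q] *)
  have half V1 W1 : open V1 -> open W1 -> V1 `&` W1 = set0 ->
      F `<=` V1 `|` W1 -> V1 x -> Q `<=` V1.
    move=> oV1 oW1 VW1 FVW1 Vx z Qz.
    suff CFW : C (F `\` W1) by have [/FVW1[]//] := Qz _ CFW.
    case: (CF) => cF cF' FK Fx; split.
    - by apply: closedI => //; exact: open_closedC.
    - rewrite (_ : _ `\` _ = (K `\` F) `|` (F `\` V1)).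
        by apply: closedU => //; apply: closedI => //; exact: open_closedC.
      apply/seteqP; split => y.
        move=> [Ky nFy]; have [Fy|] := pselect (F y); last by left.
        right; split => // Vy; apply: nFy; split => // Wy.
        by have : (V1 `&` W1) y by []; rewrite VW1.
      move=> [[Ky Fy]|[Fy Vy]]; first by split => // -[].
      split; first exact: FK.
      by move=> [_ Wy]; case: (FVW1 y Fy).
    - by move=> y [/FK].
    - by split => // Wx; have : (V1 `&` W1) x by []; rewrite VW1.
  apply/seteqP; split; first by rewrite BH => z [].
  have [Bx|nBx] := pselect (B x).
    move=> z Qz; apply: contrapT => nBz.
    have Vz : V z by apply: (half V W) => //; exact: BV.
    have Wz : W z by apply: BW.
    by have : (V `&` W) z by []; rewrite VW.
  have Qb : Q b by move: Bb; rewrite BH => -[].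
  have Wb : W b.
    by apply: (half W V) => //; [rewrite setIC|rewrite setUC|apply: BW].
  have VWb : (V `&` W) b by split => //; exact: BV.
  by rewrite VW in VWb.
have [F CF FU] := cpt U oU (subset_trans
  (connected_component_max Qx QK coQ) sub).
by exists F; case: CF.
Qed.

(** * Irrational numbers *)

Lemma irrational_uncountable (R : realType) : ~ countable (@irrational R).
Proof.
move=> ci.
have : countable [set: R].
  rewrite -(setUv rational) -bigcup2E.
  apply: bigcup_countable => // -[|[|n]] _ //=.
  apply: sub_countable (card_image_le _ _) _; exact: countableP.
move=> /countable_lebesgue_measure0; rewrite -set_itvNyy.
by rewrite lebesgue_measure_itv/=.
Qed.

Lemma irrationalD_rat (R : realType) (x : R) (q : rat) :
  irrational x -> irrational (x + ratr q).
Proof.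
move=> ix [p _ pE]; apply: ix; exists (p - q) => //.
by rewrite rmorphB /= pE addrK.
Qed.

Lemma irrationalM_rat (R : realType) (x : R) (q : rat) :
  q != 0 -> irrational x -> irrational (x * ratr q).
Proof.
move=> q0 ix [p _ pE]; apply: ix; exists (p / q) => //.
by rewrite fmorph_div /= pE mulfK// fmorph_eq0.
Qed.

(** * Subspaces of metric spaces *)

Lemma set_type_closed_approx (R : realType) (X : metricType R) (A : set X)
    (F : set A) (p : A) : closed F ->
  (forall e : R, 0 < e -> exists2 a : A, F a & mdist (val p) (val a) < e) ->
  F p.
Proof.
move=> cF near; apply: contrapT => Fp.
have [W oW WE] : open (~` F) by exact: closed_openC.
have Wp : W (val p) by rewrite -[W _]/((set_val @^-1` W) p) WE.
have : nbhs (val p) W by exact: open_nbhs_nbhs.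
rewrite -nbhs_ballE => -[e /= e0 eW].
have [a Fa pa] := near e e0.
have : (set_val @^-1` W) a by apply: eW; rewrite ballEmdist.
by rewrite WE; apply.
Qed.

Lemma set_type_continuous_nbhs (R : realType) (X Y : metricType R) (A : set X)
    (B : set Y) (f : A -> B) (p : A) (e : R) : continuous f -> 0 < e ->
  exists W : set X, [/\ open W, W (val p) &
    forall a : A, W (val a) -> mdist (val (f p)) (val (f a)) < e].
Proof.
move=> cf e0.
have : continuous (fun a : A => val (f a)).
  move=> a; apply: (@continuous_comp _ _ _ f set_val); first exact: cf.
  exact: (@initial_continuous B Y set_val).
move=> /(_ p (ball (val (f p)) e) (nbhsx_ballx _ _ e0)).
move=> [_ [/= [W oW <-] Wp WV]].
by exists W; split => // a /WV /=; rewrite ballEmdist.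
Qed.

(** * Clopen subsets of slices of complete Erdos space *)

Section complete_erdos_theory.
Context {R : realType}.
Local Notation E := (complete_erdos R).
Implicit Types (x y z : E) (c : R).

Lemma l2norm_single_coordinate (v : nat -> R) n :
  (forall i, i <> n -> v i = 0) ->
  square_summable v /\ l2norm v = `|v n|.
Proof.
move=> v0.
have sv : \forall m \near \oo, [series v k ^+ 2]_k m = v n ^+ 2.
  exists n.+1 => // m /= nm; rewrite /series /= (bigD1_seq n) ?iota_uniq//=.
    rewrite big1 ?addr0// => i /eqP iN.
    by rewrite v0// expr0n.
  by rewrite mem_index_iota.
split; first exact: is_cvg_near_cst sv.
by rewrite /l2norm (lim_near_cst _ sv)// sqrtr_sqr.
Qed.

Lemma erdos_point_of_seq (u : nat -> R) (su : square_summable u) :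
  (forall n, irrational (u n)) -> exists x : E, forall n, val x n = u n.
Proof.
move=> iu; have Eu : L2 su \in E by rewrite inE.
by exists (SigSub Eu).
Qed.

Lemma le_l2_dist (x y : l2 R) n : `|x n - y n| <= l2_dist x y.
Proof.
apply: (@le_l2norm R (fun n => x n - y n)).
by apply: square_summableB; exact: l2_summable.
Qed.

Lemma erdos_slice_inhabited c : irrational c -> exists x, val x 0%N = c.
Proof.
(* nonzero rational multiples of [c] are irrational *)
move=> ic; pose u n := c * ratr (2^-1 ^+ n : rat).
have su : square_summable u.
  apply: (@square_summable_le _ _ (geometric (c ^+ 2) 2^-1)).
    move=> n; rewrite /geometric /= /u exprMn.
    rewrite ler_wpM2l ?sqr_ge0// rmorphXn fmorphV rmorph_nat.
    rewrite -exprM mulnC exprM lerXn2r ?nnegrE//.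
    by rewrite expr2; lra.
  by apply: is_cvg_geometric_series; rewrite ger0_norm//; lra.
have [n|x xE] := erdos_point_of_seq su.
  by apply: irrationalM_rat => //; rewrite expf_neq0.
by exists x; rewrite xE /u expr0 rmorph1 mulr1.
Qed.

Lemma erdos_shift (q : rat) n x :
  exists x' : E, (forall i, i <> n -> val x' i = val x i) /\
    val x' n = val x n + ratr q.
Proof.
pose u i := val x i + (if i == n then ratr q else 0).
have su : square_summable u.
  apply: square_summableD; first exact: l2_summable.
  by apply: (l2norm_single_coordinate (n := n) _).1 => i /eqP/negbTE ->.
have [i|x' x'E] := erdos_point_of_seq su.
  rewrite /u; case: eqP => _; last by rewrite addr0; have := set_valP x; exact.
  by apply: irrationalD_rat; have := set_valP x; exact.
exists x'; split => [i /eqP/negbTE|]; rewrite x'E /u.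
  by move=> ->; rewrite addr0.
by rewrite eqxx.
Qed.

Lemma l2_dist_shift (x y : l2 R) n :
  (forall i, i <> n -> y i = x i) -> l2_dist x y <= `|x n - y n|.
Proof.
move=> yx; rewrite /l2_dist (l2norm_single_coordinate (n := n) _).2//.
by move=> i /yx ->; rewrite subrr.
Qed.

(** Starting from [x], increase coordinate [n + 1] in steps of [1 / (n + 1)],
    which keeps it irrational.  A bounded [T] is eventually left, so some point
    [x'] in [T] has its successor [z] outside.  Coordinate [0], which selects the
    slice, never changes. *)
Lemma erdos_bounded_escape (T : set E) (y : E) (r : R) n x :
  T x -> (forall z, T z -> l2_dist (val y) (val z) <= r) ->
  exists x', [/\ T x', forall i, i <> n.+1 -> val x' i = val x i &
    exists z, [/\ ~ T z, val z 0%N = val x 0%N &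
      l2_dist (val x') (val z) <= n.+1%:R^-1]].
Proof.
move=> Tx bT.
have [s sP] := choice (fun k : nat => erdos_shift (k%:R / n.+1%:R) n.+1 x).
have s0 : s 0%N = x.
  apply/val_inj/l2_eqP => i; have [iN|iN] := pselect (i = n.+1).
    by rewrite iN (sP 0%N).2 mul0r rmorph0 addr0.
  by rewrite (sP 0%N).1.
have [k [Tk nTk]] : exists k, T (s k) /\ ~ T (s k.+1).
  apply: contrapT => h.
  have Ts k : T (s k).
    elim: k => [|k IH]; first by rewrite s0.
    by apply: contrapT => nT; apply: h; exists k.
  pose t := Num.truncn (`|val y n.+1 - val x n.+1| + r).
  have t_gt : `|val y n.+1 - val x n.+1| + r < t.+1%:R by exact: truncnS_gt.
  have st : val (s (n.+1 * t.+1)%N) n.+1 = val x n.+1 + t.+1%:R.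
    by rewrite (sP _).2 fmorph_div /= !ratr_nat natrM mulrAC mulfV ?mul1r.
  have := le_trans (le_l2_dist _ _ n.+1) (bT _ (Ts (n.+1 * t.+1)%N)).
  rewrite st opprD addrA; apply/negP; rewrite -ltNge.
  have := lerB_dist t.+1%:R (val y n.+1 - val x n.+1).
  rewrite (ger0_norm (ler0n _ _)) distrC; lra.
exists (s k); split => //; first exact: (sP k).1.
exists (s k.+1); split => //; first by rewrite (sP _).1.
apply: le_trans (l2_dist_shift (n := n.+1) _) _.
  by move=> i iN; rewrite !(sP _).1.
rewrite !(sP _).2 opprD addrACA subrr add0r -rmorphB /=.
rewrite -mulrBl -natr1 opprD addrA subrr add0r mulN1r rmorphN /= normrN.
by rewrite fmorphV rmorph_nat ger0_norm// invr_ge0.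
Qed.

(** Coordinate [i] is final from step [i] on, so the sequence has the
    coordinatewise limit [xl i = xs i i].  It is square summable because the
    partial sums of the squares of [xl - xs 0] are bounded by [r ^+ 2]; and as
    [xs n] agrees with [xl] up to [n] and with [xs 0] beyond, its distance to
    [xl] is governed by a tail of that series. *)
Lemma l2_diagonal_limit (xs : nat -> E) (r : R) :
  (forall n i, i <> n.+1 -> val (xs n.+1) i = val (xs n) i) ->
  (forall n, l2_dist (val (xs 0%N)) (val (xs n)) <= r) ->
  exists xl : E,
    (fun n => l2_dist (val xl) (val (xs n))) @ \oo --> 0.
Proof.
move=> step bd.
have xs_late n i : (i <= n)%N -> val (xs n) i = val (xs i) i.
  elim: n => [|n IH]; first by rewrite leqn0 => /eqP ->.
  rewrite leq_eqVlt => /predU1P[->//|]; rewrite ltnS => ile.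
  by rewrite step ?IH//; lia.
have xs_early n i : (n < i)%N -> val (xs n) i = val (xs 0%N) i.
  elim: n => [//|n IH] ni; rewrite step; last by lia.
  by apply: IH; lia.
pose y := val (xs 0%N).
pose d i := val (xs i) i - y i.
pose w i := d i ^+ 2.
have mono : {homo series w : n m / (n <= m)%N >-> n <= m}.
  by apply: nondecreasing_series => k _ _; exact: sqr_ge0.
have sd : square_summable d.
  apply: nondecreasing_is_cvgn => //; exists (r ^+ 2) => _ [n _ <-].
  have r0 : 0 <= r by apply: le_trans (bd 0%N); exact: l2norm_ge0.
  have sn : square_summable (fun i => y i - val (xs n) i).
    by apply: square_summableB; exact: l2_summable.
  apply: (@le_trans _ _ (l2_dist y (val (xs n)) ^+ 2)); last first.
    by rewrite lerXn2r ?nnegrE ?l2norm_ge0.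
  rewrite /l2_dist l2norm_sqr//.
  apply: le_trans (nondecreasing_cvgn_le _ sn n); last first.
    by apply: nondecreasing_series => k _ _; exact: sqr_ge0.
  rewrite /series /= !big_mkord; apply: ler_sum => i _.
  by rewrite (xs_late n i) ?(ltnW (ltn_ord i))// /d -sqrrN opprB.
have [|i|xl xlE] := @erdos_point_of_seq (fun i => val (xs i) i).
- rewrite (_ : (fun i => _) = (fun i => d i + y i)); last first.
    by apply/funext => i; rewrite /d subrK.
  by apply: square_summableD => //; exact: l2_summable.
- by have := set_valP (xs i); exact.
exists xl.
have dist2 n : l2_dist (val xl) (val (xs n)) ^+ 2 <=
    limn (series w) - series w n.+1.
  have sn : square_summable (fun i => val xl i - val (xs n) i).
    by apply: square_summableB; exact: l2_summable.
  rewrite /l2_dist l2norm_sqr//; apply: limr_le => //.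
  exists n.+1 => // m /= nm.
  rewrite lerBrDr (le_trans _ (nondecreasing_cvgn_le mono sd m))//.
  rewrite /series /= [leRHS](big_cat_nat (n := n.+1))//= [leRHS]addrC lerD2r.
  rewrite (big_cat_nat (n := n.+1))//= big_nat big1 ?add0r; last first.
    by move=> i /andP[_ ni]; rewrite xlE (xs_late n i)// subrr expr0n.
  apply: ler_sum_nat => i /andP[ni _].
  by rewrite xlE (xs_early n i).
have tail : (fun n => limn (series w) - series w n.+1) @ \oo --> 0.
  rewrite -[X in _ --> X](subrr (limn (series w))).
  apply: cvgB; first exact: cvg_cst.
  by rewrite (cvg_shiftS (series w)).
apply/cvgrPdist_lt => e e0.
have [N _ hN] := iffLR (cvgrPdist_lt _ _) tail _ (exprn_gt0 2 e0).
exists N => // n /hN /=; rewrite !sub0r !normrN => tn.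
rewrite ger0_norm ?l2norm_ge0// -(@ltr_pXn2r _ 2)// ?nnegrE ?l2norm_ge0 ?ltW//.
apply: le_lt_trans (dist2 n) _; apply: le_lt_trans tn; exact: ler_norm.
Qed.

(** Erdos's argument.  If [F] and [G] split the slice of [y], repeated escapes
    in coordinates [1], [2], ... give points [xs n] of [F] that come within
    [1 / n] of [G] and stay in a bounded set.  Their limit lies in both closed
    sets. *)
Lemma erdos_slice_unbounded (F G : set E) y (r : R) :
  closed F -> closed G ->
  (forall x, val x 0%N = val y 0%N -> F x \/ G x) ->
  F y -> (forall x, F x -> l2_dist (val y) (val x) <= r) ->
  exists x, F x /\ G x.
Proof.
move=> cF cG FG Fy Fr; apply: contrapT => disj.
pose T := [set x : E | F x /\ val x 0%N = val y 0%N].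
have Tr x : T x -> l2_dist (val y) (val x) <= r by case=> /Fr.
have ex_step (p : nat * E) : exists x', T p.2 -> [/\ T x',
    forall i, i <> p.1.+1 -> val x' i = val p.2 i & exists z, G z /\
      l2_dist (val x') (val z) <= p.1.+1%:R^-1].
  have [Tp|nTp] := pselect (T p.2); last by exists y.
  have [x' [Tx' x'E [z [nTz z0 zd]]]] := erdos_bounded_escape p.1 Tp Tr.
  exists x' => _; split => //; exists z; split => //.
  have z0' : val z 0%N = val y 0%N by rewrite z0; case: Tp.
  by case: (FG z z0') => // Fz; exfalso; exact: nTz.
have [st stP] := choice ex_step.
pose xs := nat_rect (fun=> E) y (fun n x => st (n, x)).
have Txs n : T (xs n) by elim: n => [//|n IH]; case: (stP (n, xs n) IH).
have [n i|n|xl xlim] := @l2_diagonal_limit xs r.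
- by case: (stP (n, xs n) (Txs n)) => _ + _; exact.
- exact: Tr (Txs n).
have close e : 0 < e -> exists n, l2_dist (val xl) (val (xs n.+1)) < e /\
    n.+1%:R^-1 < e.
  move=> e0; have [N _ hN] := iffLR (cvgrPdist_lt _ _) xlim _ e0.
  have [M _ hM] := iffLR (cvgrPdist_lt _ _) (@cvg_harmonic R) _ e0.
  exists (maxn N M); have /= := hN (maxn N M).+1 (leqW (leq_maxl N M)).
  have /= := hM (maxn N M) (leq_maxr N M).
  by rewrite !sub0r !normrN !ger0_norm ?l2norm_ge0 ?invr_ge0.
apply: disj; exists xl; split; apply: set_type_closed_approx => // e e0.
  have [n [xn _]] := close e e0.
  by exists (xs n.+1) => //; case: (Txs n.+1).
have [n [xn nn]] := close (e / 2) (divr_gt0 e0 (ltr0n _ 2)).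
have [_ _ [z [Gz zd]]] := stP (n, xs n) (Txs n).
exists z => //; apply: le_lt_trans (l2_dist_triangle (val (xs n.+1)) _ _) _.
by rewrite [ltRHS]splitr ltrD// (le_lt_trans zd).
Qed.

End complete_erdos_theory.

(** * Uncountably many disjoint continua *)

(** The set [Z c] is the component of [a c] in the closure of the image of the
    slice at [c], the point [a c] being in that image.  The points [a c] are
    kept as witnesses that no [Z c] is covered by finitely many others. *)
Lemma erdos_slice_components (R : realType) (X : metricType R) (A : set X)
    (f : A -> complete_erdos R) (g : complete_erdos R -> A) :
  compact [set: X] -> continuous f -> continuous g ->
  cancel g f ->
  exists (a : R -> X) (Z : R -> set X), forall c, irrational c ->
    [/\ nondegenerate_subcontinuum (Z c), Z c (a c) &
      forall d, irrational d -> d <> c -> ~ Z c (a d)].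
Proof.
move=> cX cf cg gf.
have [b bE] : exists b : R -> complete_erdos R,
    forall c, irrational c -> val (b c) 0%N = c.
  have h c : exists x : complete_erdos R, irrational c -> val x 0%N = c.
    have [ic|nic] := pselect (irrational c).
      by have [x xc] := erdos_slice_inhabited ic; exists x.
    have [d id] : exists d, @irrational R d.
      apply: contrapT => nd; apply: (@irrational_uncountable R).
      rewrite (_ : irrational = set0); first exact: countable0.
      by rewrite -subset0 => d id; apply: nd; exists d.
    by have [x _] := erdos_slice_inhabited id; exists x.
  by have [b bP] := choice h; exists b.
pose a c := val (g (b c)).
pose S c := [set val (g x) | x in [set x : complete_erdos R | val x 0%N = c]].
have Sa c : irrational c -> S c (a c).
  by move=> ic; exists (b c) => //=; exact: bE.
pose H c := closure (S c).
have cH c : compact (H c).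
  by apply: subclosed_compact cX _ => //; exact: closed_closure.
have Ha c : irrational c -> H c (a c) by move=> ic; exact/subset_closure/Sa.
pose Z c := connected_component (H c) (a c).
exists a, Z => c ic; split.
- split.
  + have clZ : closed (Z c) by apply: component_closed; exact: closed_closure.
    by apply: subclosed_compact clZ (cH c) _; exact: connected_component_sub.
  + exact: component_connected.
  + exists (a c); apply: contrapT => Z1.
    have {}Z1 : Z c `<=` [set a c].
      move=> z Zz; apply: contrapT => za; apply: Z1; exists z; split => //.
        exact/connected_component_refl/Ha.
      exact: nesym.
    have [W [oW Wa Wf]] := set_type_continuous_nbhs (g (b c)) cf ltr01.
    have [|F [cF cF' FH Fa FW]] :=
      component_clopen_nbhs (U := W) (cH c) (Ha c ic) oW.
      by move=> z /Z1 ->.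
    have cvg : continuous (fun x : complete_erdos R => val (g x)).
      move=> x; apply: (@continuous_comp _ _ _ g set_val); first exact: cg.
      exact: (@initial_continuous A X set_val).
    have clp := iffLR (continuous_closedP _) cvg.
    have [x xc|x Fx|x [Fx [_ nFx]]//] :=
      erdos_slice_unbounded (y := b c) (r := 1) (clp _ cF) (clp _ cF') _ Fa _.
      have Hx : H c (val (g x)).
        by apply: subset_closure; exists x => //=; rewrite xc bE.
      by have [Fx|nFx] := pselect (F (val (g x))); [left|right].
    by have := Wf _ (FW _ Fx); rewrite !gf; exact: ltW.
- exact/connected_component_refl/Ha.
- move=> d id dc /connected_component_sub Hd.
  have dc0 : 0 < `|d - c| by rewrite normr_gt0 subr_eq0; exact/eqP.
  have [W [oW Wd Wf]] := set_type_continuous_nbhs (g (b d)) cf dc0.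
  have [_ [[x /= xc <-] Wx]] := Hd W (open_nbhs_nbhs (conj oW Wd)).
  have := Wf _ Wx; rewrite !gf; apply/negP; rewrite -leNgt.
  by have := le_l2_dist (val (b d)) (val x) 0%N; rewrite bE// xc.
Qed.

Theorem corollary3 (R : realType) :
  (forall X : metricType R, continuum X -> chainable X ->
     (exists A : set X, homeomorphic A (complete_erdos R)) ->
     ~ suslinian X)
  /\
  (forall X : metricType R, continuum X -> chainable X -> suslinian X ->
     ~ homeomorphic (complete_erdos R) (endpoints X)).
Proof.
have main (X : metricType R) : continuum X -> chainable X ->
    (exists A : set X, homeomorphic A (complete_erdos R)) -> ~ suslinian X.
  move=> [cX _] chX [A [f [g [cf cg _ gf]]]]; apply.
  have [a [Z ZP]] := erdos_slice_components cX cf cg gf.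
  have sep c d : irrational c -> irrational d -> c <> d -> ~ Z c (a d).
    by move=> ic id cd; have [_ _] := ZP c ic; apply=> //; exact: nesym.
  have [||D [nD Dirr tD]] := @uncountable_disjoint_subfamily X R irrational Z.
  - exact: irrational_uncountable.
  - move=> c cinj ic cc.
    have [i|i|//|i /(_ (a (c i)))] := chainable_atriodic (Z := Z \o c) chX.
    + have [[+ _ _] _ _] := ZP _ (ic i).
      by apply: compact_closed; exact: metric_hausdorff.
    + by have [[]] := ZP _ (ic i).
    + case; first by case: (ZP _ (ic i)).
      by move=> j /= ji; apply: sep => // /cinj.
  exists (Z @` D); split.
  - apply: contra_not nD => /countable_injP[h hinj]; apply/countable_injP.
    exists (h \o Z) => c d /set_mem Dc /set_mem Dd /= hcd.
    have Zcd : Z c = Z d by apply: hinj => //; rewrite inE; [exists c|exists d].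
    apply: contrapT => cd; apply: (sep c d) => //; [exact: Dirr|exact: Dirr|].
    by rewrite Zcd; have [] := ZP d (Dirr _ Dd).
  - by move=> _ [c /Dirr/ZP[ndc _ _] <-].
  - by move=> _ _ [c Dc <-] [d Dd <-] /(tD c d Dc Dd) ->.
split=> // X kX chX sX [f [g [cf cg fg gf]]]; apply: (main X) => //.
by exists (endpoints X), g, f.
Qed.
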